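(* Let $A[1..n]$ and $B[1..m]$ be sequences with $m\le n$, let $L$ be the number of pairs $(i,j)$ with $A[i]=B[j]$, and let $k$ be the length of a longest common subsequence of $A$ and $B$. There is a parallel algorithm (the Cordon Algorithm combined with a tournament tree) in the binary-forking work-span model that computes the longest common subsequence length (the DP values of the standard LCS recurrence) with $O(L\log n)$ work and $O(k\log n)$ span.
   Context: The binary-forking work-span model: threads share memory, each acting as a sequential RAM with an additional fork instruction creating two parallel threads that must both finish before the parent continues. Work is the total number of operations; span is the length of the longest dependency chain. The LCS recurrence is $D[i,j]=0$ if $i=0$ or $j=0$; $D[i,j]=D[i-1,j-1]+1$ if $A[i]=B[j]$; $D[i,j]=\max\{D[i-1,j],D[i,j-1]\}$ otherwise. The paper states this algorithm is a perfect parallelization of the sequential sparse LCS algorithm, meaning it processes asymptotically the same transitions (the diagonal transitions $(i-1,j-1)\to(i,j)$ with $A[i]=B[j]$) with asymptotically the same work, and has span proportional (up to polylogarithmic factors) to the maximum number of such transitions on a dependency path, which equals $k$.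
   Formalization: The algorithm is given n, m, L and the row-major list of the L pairs with A[i]=B[j], since reading raw A and B already exceeds O(L log n) work for small L; it outputs D[n,m] and the DP values at those pairs, not the whole table; O(f) means at most C·max(1,f). *)

(* Defs.v *)
From mathcomp Require Import all_boot.

Set Implicit Arguments.
Unset Strict Implicit.
Unset Printing Implicit Defensive.

Section LCS.
Variable T : eqType.
Implicit Types A B s : seq T.

Definition common_subseq s A B := subseq s A && subseq s B.

Definition is_lcs s A B :=
  common_subseq s A B /\
  forall s', common_subseq s' A B -> size s' <= size s.

(* Positions are numbered from 1; both positions are meant to be in range. *)
Definition matched A B (i j : nat) := onth A i.-1 == onth B j.-1.

Fixpoint lcs_dp A B (i : nat) : nat -> nat :=
  if i is i'.+1 then
    fix row (j : nat) : nat :=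
      if j is j'.+1 then
        if matched A B i j then (lcs_dp A B i' j').+1
        else maxn (lcs_dp A B i' j) (row j')
      else 0
  else fun=> 0.

(* In row-major order: by increasing i, then by increasing j. *)
Definition matches A B : seq (nat * nat) :=
  [seq p <- [seq (i, j) | i <- iota 1 (size A), j <- iota 1 (size B)]
     | matched A B p.1 p.2].

End LCS.

Definition memory := nat -> nat.
Definition registers := nat -> nat.

Definition update (f : nat -> nat) (a v : nat) : nat -> nat :=
  fun b => if b == a then v else f b.

Inductive arith := Add | Sub | Mul | Div.

Definition eval_arith (o : arith) : nat -> nat -> nat :=
  match o with Add => addn | Sub => subn | Mul => muln | Div => divn end.

(* Register operands come destination first. Sub truncates at 0 and division
   by 0 gives 0. *)
Inductive instr :=
| Const of nat & nat               (* rd <- constant *)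
| Arith of arith & nat & nat & nat (* rd <- r1 op r2 *)
| Read of nat & nat                (* rd <- mem[ra] *)
| Write of nat & nat               (* mem[ra] <- rs *)
| Jump of nat
| JumpLt of nat & nat & nat        (* if r1 < r2 goto label *)
| Fork of nat & nat
| Halt.

Definition program := seq instr.

Section BinaryForking.
Variables (w : nat) (P : program).

(* Machine words are the numbers below w; an instruction whose result is not
   a word has no transition, i.e. the thread is stuck. *)
Definition set_reg (rs : registers) (r v : nat) : option registers :=
  if v < w then Some (update rs r v) else None.

Definition exec (i : instr) (pc : nat) (rs : registers) (mem : memory) :
    option (nat * registers * memory) :=
  match i with
  | Const rd v => omap (fun rs' => (pc.+1, rs', mem)) (set_reg rs rd v)
  | Arith o rd r1 r2 =>
      omap (fun rs' => (pc.+1, rs', mem))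
           (set_reg rs rd (eval_arith o (rs r1) (rs r2)))
  | Read rd ra =>
      omap (fun rs' => (pc.+1, rs', mem)) (set_reg rs rd (mem (rs ra)))
  | Write ra r => Some (pc.+1, rs, update mem (rs ra) (rs r))
  | Jump l => Some (l, rs, mem)
  | JumpLt r1 r2 l => Some (if rs r1 < rs r2 then l else pc.+1, rs, mem)
  | Fork _ _ | Halt => None
  end.

(* Registers are private to a thread. The last argument of Running and Halted
   is the number of operations on a longest dependency chain ending at the
   current point of the thread. *)
Inductive thread :=
| Running of nat & registers & nat
| Suspended of nat & registers & thread & thread
| Halted of nat.

Definition config : Type := thread * memory.

(* One atomic operation of one thread, chosen arbitrarily among those that can
   proceed: the relation ranges over all interleavings. The two threads created
   by a fork start with a copy of the registers of their parent. *)
Inductive step : config -> config -> Prop :=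
| step_exec i pc rs d mem pc' rs' mem' :
    onth P pc = Some i -> exec i pc rs mem = Some (pc', rs', mem') ->
    step (Running pc rs d, mem) (Running pc' rs' d.+1, mem')
| step_halt pc rs d mem :
    onth P pc = Some Halt ->
    step (Running pc rs d, mem) (Halted d.+1, mem)
| step_fork l1 l2 pc rs d mem :
    onth P pc = Some (Fork l1 l2) ->
    step (Running pc rs d, mem)
         (Suspended pc.+1 rs (Running l1 rs d.+1) (Running l2 rs d.+1), mem)
| step_left pc rs t1 t1' t2 mem mem' :
    step (t1, mem) (t1', mem') ->
    step (Suspended pc rs t1 t2, mem) (Suspended pc rs t1' t2, mem')
| step_right pc rs t1 t2 t2' mem mem' :
    step (t2, mem) (t2', mem') ->
    step (Suspended pc rs t1 t2, mem) (Suspended pc rs t1 t2', mem')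
| step_join pc rs d1 d2 mem :
    step (Suspended pc rs (Halted d1) (Halted d2), mem)
         (Running pc rs (maxn d1 d2).+1, mem).

Inductive nsteps : nat -> config -> config -> Prop :=
| nsteps0 c : nsteps 0 c c
| nstepsS t c c' c'' : nsteps t c c' -> step c' c'' -> nsteps t.+1 c c''.

Definition initial (mem : memory) : config := (Running 0 (fun=> 0) 0, mem).

(* Under every interleaving, the program never gets stuck, performs at most
   `work` operations in total, and ends with span at most `span` in a memory
   satisfying Q. *)
Definition runs_within (mem : memory) (work span : nat) (Q : memory -> Prop) :=
  forall t c, nsteps t (initial mem) c ->
    t <= work /\
    match c with
    | (Halted d, mem') => d <= span /\ Q mem'
    | _ => exists c', step c c'
    end.

End BinaryForking.

(* The sparse LCS instance: n, m, L, then the L matching pairs as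
   i_1, j_1, i_2, j_2, and so on; all other cells are 0. *)
Definition sparse_input (T : eqType) (A B : seq T) : memory :=
  nth 0 [:: size A, size B, size (matches A B)
         & flatten [seq [:: p.1; p.2] | p <- matches A B]].

(* An operation count is at least 1, so O(f) means at most a constant times
   max(1, f); this matters only when f = 0, i.e. when L = 0 or n <= 1. *)
Definition bigO_bound (C f : nat) : nat := C * maxn 1 f.

(* Main.v *)
(* Proof idea. The D-value of a matching pair is the length of a longest chain
   of matching pairs, strictly increasing in both coordinates, that ends at it.
   So the pairs of value r are the ones that become minimal once those of
   smaller value are removed, and k rounds of removal suffice. Order the pairs
   by increasing row and, within a row, by decreasing column: a pair is minimal
   iff its column is at most that of every remaining earlier pair. A tournament
   tree of column minima finds these pairs: the recursion hands down the minimum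
   of everything to the left and stops at subtrees whose own minimum is larger.
   A visited subtree that is not pruned contains a removed leaf, so the rounds
   together cost O(log L) per pair, and each has span O(log L), where
   log L <= 2 log n. The
   input lists the pairs of a row by increasing column; binary search for the
   boundaries of its row gives each pair its mirror position.

   Correctness under all interleavings rests on an ownership discipline: the two
   threads of a fork write disjoint memory, and neither reads what the other
   writes. *)
Require Import Defs.
From mathcomp Require Import all_boot zify.

Set Implicit Arguments.
Unset Strict Implicit.
Unset Printing Implicit Defensive.

Definition agree (F : nat -> Prop) (mem mem' : memory) :=
  forall a, F a -> mem a = mem' a.

Lemma agree_refl F mem : agree F mem mem.
Proof. by []. Qed.

Lemma agree_trans F mem1 mem2 mem3 :
  agree F mem1 mem2 -> agree F mem2 mem3 -> agree F mem1 mem3.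
Proof. by move=> e12 e23 a Fa; rewrite e12 // e23. Qed.

Lemma agree_sub (F G : nat -> Prop) mem mem' :
  (forall a, G a -> F a) -> agree F mem mem' -> agree G mem mem'.
Proof. by move=> GF e a /GF; apply: e. Qed.

Definition union (F G : nat -> Prop) a := F a \/ G a.

Section Logic.
Variables (w : nat) (P : program).

Local Notation step := (step w P).

(* Other threads may at any time change the memory outside [own] and [rd];
   this thread changes it inside [own] only. *)
Fixpoint safe (work : nat) (own rd : nat -> Prop) (t : thread) (mem : memory)
    (Q : nat -> memory -> Prop) : Prop :=
  forall mem', agree (union own rd) mem mem' ->
  match t, work with
  | Halted d, _ => Q d mem'
  | _, 0 => False
  | _, work'.+1 =>
      (exists c, step (t, mem') c) /\
      forall t' mem'', step (t, mem') (t', mem'') ->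
        agree (fun a => ~ own a) mem' mem'' /\ safe work' own rd t' mem'' Q
  end.

Lemma safe_agree W own rd t mem mem' Q :
  agree (union own rd) mem mem' -> safe W own rd t mem Q ->
  safe W own rd t mem' Q.
Proof. by case: W => [|W] e H m2 e2; apply: (H m2 (agree_trans e e2)). Qed.

Lemma safe_leq W W' own rd t mem Q :
  W <= W' -> safe W own rd t mem Q -> safe W' own rd t mem Q.
Proof.
elim: W W' t mem => [|W IH] [|W'] t mem //.
  by move=> _ H m2 /H; case: t {H}.
move=> leW H m2 /H; case: t {H} => [pc rs d|pc rs t1 t2|d] // [st H];
  by split=> // t' m3 /H [e /IH S]; split=> //; apply: S.
Qed.

Lemma safe_conseq W own rd t mem (Q Q' : nat -> memory -> Prop) :
  (forall d mem', Q d mem' -> Q' d mem') ->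
  safe W own rd t mem Q -> safe W own rd t mem Q'.
Proof.
move=> QQ'; elim: W t mem => [|W IH] t mem.
  by move=> H m2 /H; case: t {H} => // d; apply: QQ'.
move=> H m2 /H; case: t {H} => [pc rs d|pc rs t1 t2|d] //; last exact: QQ';
  by move=> [st H]; split=> // t' m3 /H [e /IH S].
Qed.

Lemma safe_stepE W own rd t t' mem mem' Q :
  step (t, mem) (t', mem') -> safe W own rd t mem Q ->
  exists W', [/\ W = W'.+1, agree (fun a => ~ own a) mem mem'
                & safe W' own rd t' mem' Q].
Proof.
move=> st; case: W => [|W] /(_ _ (@agree_refl _ _)).
  by case: t st => // d st; inversion st.
case: t st => [pc rs d|pc rs t1 t2|d] st; last by inversion st.
all: by case=> _ /(_ _ _ st) [e S]; exists W.
Qed.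

Lemma safe_progress W own rd t mem Q :
  safe W own rd t mem Q ->
  (exists2 d, t = Halted d & Q d mem) \/ (exists c, step (t, mem) c).
Proof.
case: W => [|W] /(_ _ (@agree_refl _ _));
  case: t => [pc rs d|pc rs t1 t2|d] // H;
  by [left; exists d|right; case: H].
Qed.

Lemma safe_nsteps W Q mem t c :
  safe W (fun=> True) (fun=> False) (Running 0 (fun=> 0) 0) mem Q ->
  nsteps w P t (initial mem) c ->
  t <= W /\ safe (W - t) (fun=> True) (fun=> False) c.1 c.2 Q.
Proof.
move=> S0 H.
have [c0 e0]: exists c0, c0 = initial mem by eexists.
rewrite -e0 in H.
elim: H e0 => {t c c0} [c -> |t c [t1 m1] [t2 m2] H IH st e]; first by rewrite subn0.
have [letW /(safe_stepE st) [W' [eW _ S]]] := IH e.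
by split; [lia|rewrite (_ : W - t.+1 = W'); last lia].
Qed.

Lemma safe_runs_within mem W S (Q : memory -> Prop) :
  safe W (fun=> True) (fun=> False) (Running 0 (fun=> 0) 0) mem
    (fun d mem' => d <= S /\ Q mem') ->
  runs_within w P mem W S Q.
Proof.
move=> S0 t [t' m'] /(safe_nsteps S0) [leW] /= S1; split=> //.
by case: (safe_progress S1) => [[d ->]|] //; case: t' S1 => // d _ [c st]; inversion st.
Qed.

Lemma step_suspendedE pc rs t1 t2 mem t' mem' :
  step (Suspended pc rs t1 t2, mem) (t', mem') ->
  [\/ exists2 t1', step (t1, mem) (t1', mem') & t' = Suspended pc rs t1' t2,
      exists2 t2', step (t2, mem) (t2', mem') & t' = Suspended pc rs t1 t2'
    | exists d1 d2, [/\ t1 = Halted d1, t2 = Halted d2,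
                       t' = Running pc rs (maxn d1 d2).+1 & mem' = mem]].
Proof.
move=> st; inversion st; subst.
- by apply: Or31; eexists; eauto.
- by apply: Or32; eexists; eauto.
- by apply: Or33; exists d1, d2.
Qed.

Lemma safe_par W1 W2 W3 (own own1 own2 rd rd1 rd2 : nat -> Prop)
    pc rs t1 t2 mem Q1 Q2 Q :
  (forall a, own1 a -> own a) -> (forall a, own2 a -> own a) ->
  (forall a, rd1 a -> union own rd a) -> (forall a, rd2 a -> union own rd a) ->
  (forall a, own1 a -> ~ union own2 rd2 a) ->
  (forall a, own2 a -> ~ union own1 rd1 a) ->
  safe W1 own1 rd1 t1 mem Q1 -> safe W2 own2 rd2 t2 mem Q2 ->
  (forall d1 d2 mem',
     agree (fun a => union own rd a /\ ~ union own1 own2 a) mem mem' ->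
     Q1 d1 mem' -> Q2 d2 mem' ->
     safe W3 own rd (Running pc rs (maxn d1 d2).+1) mem' Q) ->
  safe (W1 + W2 + W3).+1 own rd (Suspended pc rs t1 t2) mem Q.
Proof.
move=> o1 o2 r1 r2 dis1 dis2.
have [W eW] : exists W, W = W1 + W2 by eexists.
elim: W W1 W2 eW t1 t2 mem => [|W IH] W1 W2 eW t1 t2 mem S1 S2 S3 mem' e.
all: have {}S1: safe W1 own1 rd1 t1 mem' Q1
  by apply: safe_agree S1; apply: agree_sub e => a [/o1|/r1]; [left|].
all: have {}S2: safe W2 own2 rd2 t2 mem' Q2
  by apply: safe_agree S2; apply: agree_sub e => a [/o2|/r2]; [left|].
all: have {}S3 d1 d2 mem'' :
  agree (fun a => union own rd a /\ ~ union own1 own2 a) mem' mem'' ->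
  Q1 d1 mem'' -> Q2 d2 mem'' ->
  safe W3 own rd (Running pc rs (maxn d1 d2).+1) mem'' Q
  by move=> e'; apply: S3; apply: agree_trans e';
     apply: agree_sub e => a [].
all: split; first
  by case: (safe_progress S1) => [[d1 -> _]|[[t1' m1] st]];
     [case: (safe_progress S2) => [[d2 -> _]|[[t2' m2] st]]|];
     eexists; [exact: step_join|exact: step_right st|exact: step_left st].
all: move=> t' m'' /step_suspendedE [] => [[t1' st ->]|[t2' st ->]|
  [d1 [d2 [e1 e2 -> ->]]]]; try by
    [have [? [? _ _]] := safe_stepE st S1; lia
    |have [? [? _ _]] := safe_stepE st S2; lia].
- split=> //; apply: (@safe_leq W3); first lia.
  apply: S3 => //; [case: (safe_progress S1)|case: (safe_progress S2)];
    rewrite ?e1 ?e2; by [case=> d [<-]|case=> c st; inversion st].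
- have [W1' [eW1 e1 {}S1]] := safe_stepE st S1.
  split; first by apply: agree_sub e1 => a no /o1.
  apply: (@safe_leq (W1' + W2 + W3).+1); first lia.
  apply: IH => //; first lia.
    by apply: safe_agree S2; apply: agree_sub e1 => a u2 /dis1.
  move=> d1 d2 m3 e3; apply: S3; apply: agree_trans e3.
  by apply: agree_sub e1 => a [_ nu] u; apply: nu; left.
- have [W2' [eW2 e2 {}S2]] := safe_stepE st S2.
  split; first by apply: agree_sub e2 => a no /o2.
  apply: (@safe_leq (W1 + W2' + W3).+1); first lia.
  apply: IH => //; first lia.
    by apply: safe_agree S1; apply: agree_sub e2 => a u1 /dis2.
  move=> d1 d2 m3 e3; apply: S3; apply: agree_trans e3.
  by apply: agree_sub e2 => a [_ nu] u; apply: nu; right.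
- split=> //; apply: (@safe_leq W3); first lia.
  apply: S3 => //; [case: (safe_progress S1)|case: (safe_progress S2)];
    rewrite ?e1 ?e2; by [case=> d [<-]|case=> c st; inversion st].
Qed.

Lemma step_runningE i pc rs d mem t' mem' :
  onth P pc = Some i -> step (Running pc rs d, mem) (t', mem') ->
  match i with
  | Halt => t' = Halted d.+1 /\ mem' = mem
  | Fork l1 l2 =>
      t' = Suspended pc.+1 rs (Running l1 rs d.+1) (Running l2 rs d.+1) /\
      mem' = mem
  | _ => exists pc' rs', exec w i pc rs mem = Some (pc', rs', mem') /\
                         t' = Running pc' rs' d.+1
  end.
Proof.
move=> iP st; inversion st; subst.
- match goal with iP' : onth P _ = Some _, ex : exec _ _ _ _ _ = _ |- _ =>
    move: iP' ex
  end.
  rewrite iP => -[<-]; clear.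
  by case: i => // *; do 2 eexists; split; eauto.
all: match goal with iP' : onth P _ = Some _ |- _ =>
       by move: iP'; rewrite iP => -[->] end.
Qed.

Section Instructions.
Variables (W : nat) (own rd : nat -> Prop) (pc : nat) (rs : registers).
Variables (d : nat) (mem : memory) (Q : nat -> memory -> Prop).

Local Notation goal W := (safe W own rd (Running pc rs d) mem Q).

Lemma safe_exec i pc' rs' (f : memory -> memory) :
  onth P pc = Some i ->
  (forall mem', agree (union own rd) mem mem' ->
     [/\ exec w i pc rs mem' = Some (pc', rs', f mem'),
         agree (fun a => ~ own a) mem' (f mem')
       & agree (union own rd) (f mem) (f mem')]) ->
  safe W own rd (Running pc' rs' d.+1) (f mem) Q -> goal W.+1.
Proof.
move=> iP H S mem' /H [ex e1 e2]; split.
  by eexists; apply: step_exec; eauto.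
move=> t' m'' /(step_runningE iP) {iP}st.
have {st}[? [? []]]: exists pc'' rs'',
    exec w i pc rs mem' = Some (pc'', rs'', m'') /\
    t' = Running pc'' rs'' d.+1 by move: st ex; clear; case: i.
rewrite ex => -[<- <- <-] ->; split=> //.
exact: safe_agree S.
Qed.

Lemma safe_const r v :
  onth P pc = Some (Const r v) -> v < w ->
  safe W own rd (Running pc.+1 (update rs r v) d.+1) mem Q -> goal W.+1.
Proof.
move=> iP ltw; apply: (safe_exec (f := id) iP) => mem' e.
by rewrite /= /set_reg ltw.
Qed.

Lemma safe_arith o r r1 r2 v :
  onth P pc = Some (Arith o r r1 r2) -> eval_arith o (rs r1) (rs r2) = v ->
  v < w ->
  safe W own rd (Running pc.+1 (update rs r v) d.+1) mem Q -> goal W.+1.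
Proof.
move=> iP ev ltw; apply: (safe_exec (f := id) iP) => mem' e.
by rewrite /= /set_reg ev ltw.
Qed.

Lemma safe_read r ra v :
  onth P pc = Some (Read r ra) -> union own rd (rs ra) -> mem (rs ra) = v ->
  v < w ->
  safe W own rd (Running pc.+1 (update rs r v) d.+1) mem Q -> goal W.+1.
Proof.
move=> iP ua ev ltw; apply: (safe_exec (f := id) iP) => mem' e.
by rewrite /= /set_reg -(e _ ua) ev ltw.
Qed.

Lemma safe_write ra r a v :
  onth P pc = Some (Write ra r) -> rs ra = a -> rs r = v -> own a ->
  safe W own rd (Running pc.+1 rs d.+1) (update mem a v) Q -> goal W.+1.
Proof.
move=> iP ea ev oa; apply: (safe_exec (f := fun m => update m a v) iP) => mem' e.
split; first by rewrite /= ea ev.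
  by move=> b nb; rewrite /update; case: eqP => // eb; case: nb; rewrite eb.
by move=> b ub; rewrite /update; case: eqP => // _; apply: e.
Qed.

Lemma safe_jump l :
  onth P pc = Some (Jump l) ->
  safe W own rd (Running l rs d.+1) mem Q -> goal W.+1.
Proof. by move=> iP; apply: (safe_exec (f := id) iP) => mem' e. Qed.

Lemma safe_jumplt r1 r2 l :
  onth P pc = Some (JumpLt r1 r2 l) ->
  safe W own rd (Running (if rs r1 < rs r2 then l else pc.+1) rs d.+1) mem Q ->
  goal W.+1.
Proof. by move=> iP; apply: (safe_exec (f := id) iP) => mem' e. Qed.

Lemma safe_halt :
  onth P pc = Some Halt ->
  (forall mem', agree (union own rd) mem mem' -> Q d.+1 mem') -> goal W.+1.
Proof.
move=> iP H mem' e; split; first by eexists; apply: step_halt.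
move=> t' m'' /(step_runningE iP) [-> ->]; split=> //.
case: (W) => [|?] m3 e3; apply: H; exact: agree_trans e3.
Qed.

Lemma safe_fork l1 l2 (W1 W2 : nat) (own1 own2 rd1 rd2 : nat -> Prop) Q1 Q2 :
  onth P pc = Some (Fork l1 l2) ->
  (forall a, own1 a -> own a) -> (forall a, own2 a -> own a) ->
  (forall a, rd1 a -> union own rd a) -> (forall a, rd2 a -> union own rd a) ->
  (forall a, own1 a -> ~ union own2 rd2 a) ->
  (forall a, own2 a -> ~ union own1 rd1 a) ->
  safe W1 own1 rd1 (Running l1 rs d.+1) mem Q1 ->
  safe W2 own2 rd2 (Running l2 rs d.+1) mem Q2 ->
  (forall d1 d2 mem',
     agree (fun a => union own rd a /\ ~ union own1 own2 a) mem mem' ->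
     Q1 d1 mem' -> Q2 d2 mem' ->
     safe W own rd (Running pc.+1 rs (maxn d1 d2).+1) mem' Q) ->
  goal (W1 + W2 + W).+2.
Proof.
move=> iP o1 o2 r1 r2 dis1 dis2 S1 S2 S3 mem' e; split.
  by eexists; apply: step_fork; eauto.
move=> t' m'' /(step_runningE iP) [-> ->]; split=> //.
exact: (safe_agree e (safe_par o1 o2 r1 r2 dis1 dis2 S1 S2 S3)).
Qed.

End Instructions.

End Logic.

#[global] Opaque safe.

(** * Tournament tree values *)

Lemma eq_from_leq x y : (forall v, (v <= x) = (v <= y)) -> x = y.
Proof. by move=> e; apply/eqP; rewrite eqn_leq -e leqnn e leqnn. Qed.

Section Tournament.
Variables (L M : nat) (key rank : nat -> nat).
Hypothesis keyM : forall p, p < L -> key p <= M.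
Hypothesis rank_gt0 : forall p, p < L -> 0 < rank p.
Hypothesis rank_lt : forall p q, p < q -> q < L -> key p < key q -> rank p < rank q.
Hypothesis rank_pred : forall q r, q < L -> r.+1 < rank q ->
  exists p, [/\ p < q, key p < key q & r < rank p].

Definition min_key r v0 lo s :=
  foldr minn v0 [seq key p | p <- iota lo s & r < rank p].

(* The tournament tree passes through the stages 0 (all cells are 0), 1 (all
   leaves present), 2 (the leaves of rank 1 removed), and so on; [min_prefix]
   is the bound handed down to a subtree whose first leaf is [lo]. *)
Definition node_value stage lo s :=
  if stage is r.+1 then min_key r M.+1 lo s else 0.

Definition min_prefix stage lo :=
  if stage is r.+1 then min_key r M 0 lo else if lo == 0 then M else 0.

Definition active stage p := if stage is _.+1 then rank p == stage else true.

Lemma leq_min_key v r v0 lo s :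
  (v <= min_key r v0 lo s) =
  (v <= v0) && all (fun p => (r < rank p) ==> (v <= key p)) (iota lo s).
Proof.
rewrite /min_key; elim: (iota lo s) => [|p l IH] /=; first by rewrite andbT.
by case: (r < rank p); rewrite /= ?leq_min IH // andbCA.
Qed.

Lemma node_valueD stage lo s1 s2 :
  node_value stage lo (s1 + s2) =
  minn (node_value stage lo s1) (node_value stage (lo + s1) s2).
Proof.
case: stage => [|r] /=; first by rewrite minnn.
apply: eq_from_leq => v; rewrite leq_min !leq_min_key iotaD all_cat.
by case: (v <= M.+1).
Qed.

Lemma min_prefixD stage lo s : 0 < s ->
  min_prefix stage (lo + s) = minn (min_prefix stage lo) (node_value stage lo s).
Proof.
move=> s0; case: stage => [|r] /=; first by rewrite minn0 ifF //; lia.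
apply: eq_from_leq => v; rewrite leq_min !leq_min_key iotaD all_cat.
by case: (leqP v M) => //= vM; rewrite (leq_trans vM).
Qed.

Lemma node_value_max stage lo s : node_value stage lo s <= M.+1.
Proof.
case: stage => //= r; move: (leqnn (min_key r M.+1 lo s)).
by rewrite leq_min_key => /andP[].
Qed.

Lemma min_key_attained r v0 lo s : min_key r v0 lo s < v0 ->
  exists p, [/\ lo <= p < lo + s, r < rank p & key p = min_key r v0 lo s].
Proof.
move=> H; have: ~~ (minn v0 (min_key r v0 lo s).+1 <= min_key r v0 lo s) by lia.
rewrite leq_min_key geq_minl /= => /allPn[p]; rewrite mem_iota => pin.
rewrite negb_imply => /andP[rp kp]; exists p; split=> //.
move: (leqnn (min_key r v0 lo s)); rewrite leq_min_key => /andP[_ /allP /(_ p)].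
rewrite mem_iota pin rp => /(_ isT) /=.
by lia.
Qed.

Lemma active_present r p : p < L ->
  (rank p == r.+1) = (r < rank p) && (key p <= min_key r M 0 p).
Proof.
move=> pL; rewrite leq_min_key keyM //=; apply/eqP/andP => [e|[rp /allP H]].
  split; first lia.
  apply/allP => q; rewrite mem_iota /= add0n => qp; apply/implyP => rq.
  by rewrite leqNgt; apply/negP => kq; have := rank_lt qp pL kq; lia.
apply/eqP; rewrite eqn_leq rp andbT leqNgt; apply/negP => /(rank_pred pL)[q [qp kq rq]].
by have := H q; rewrite mem_iota /= add0n qp rq => /(_ isT) /=; lia.
Qed.

Lemma node_value_leq_prefix stage lo s : 0 < s -> lo + s <= L ->
  (node_value stage lo s <= min_prefix stage lo) = has (active stage) (iota lo s).
Proof.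
move=> s0 loL; case: stage => [|r] /=; first by case: s s0 {loL}.
apply/idP/hasP => [H|[p]].
  have [|p [pin rp kp]] := @min_key_attained r M.+1 lo s.
    by apply: leq_ltn_trans H _; move: (leqnn (min_key r M 0 lo)); rewrite leq_min_key => /andP[].
  exists p; first by rewrite mem_iota.
  rewrite /active active_present; last lia.
  rewrite rp leq_min_key keyM; last lia.
  apply/allP => q; rewrite mem_iota add0n /= => qp; apply/implyP => rq.
  rewrite kp; case: (ltnP q lo) => qlo.
    move: H; rewrite leq_min_key => /andP[_ /allP/(_ q)].
    by rewrite mem_iota add0n qlo rq => /(_ isT).
  move: (leqnn (min_key r M.+1 lo s)); rewrite leq_min_key => /andP[_ /allP/(_ q)].
  by rewrite mem_iota qlo rq /=; apply; lia.
rewrite mem_iota => pin; rewrite /active active_present; last lia.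
move=> /andP[rp kp].
apply: leq_trans (_ : key p <= _).
  move: (leqnn (min_key r M.+1 lo s)); rewrite leq_min_key => /andP[_ /allP/(_ p)].
  by rewrite mem_iota pin rp => /(_ isT).
move: kp; rewrite !leq_min_key => /andP[-> /allP H] /=.
by apply/allP => q; rewrite mem_iota => qin; apply: H; rewrite mem_iota; lia.
Qed.

Lemma node_value_inactive stage lo s : 0 < s ->
  ~~ has (active stage) (iota lo s) ->
  node_value stage.+1 lo s = node_value stage lo s.
Proof.
case: stage => [|r]; first by case: s.
move=> _ /hasPn H; apply: eq_from_leq => v; rewrite /= !leq_min_key; congr (_ && _).
by apply: eq_in_all => p /H /= ne; congr (_ ==> _); lia.
Qed.

Lemma node_value_removed stage p :
  0 < stage -> active stage p -> node_value stage.+1 p 1 = M.+1.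
Proof. by case: stage => // r _ /eqP e; rewrite /= /min_key /= e ltnn. Qed.

Lemma node_value1 p : p < L -> node_value 1 p 1 = key p.
Proof.
by move=> pL; rewrite /= /min_key /= rank_gt0 //=; have := keyM pL; lia.
Qed.

Lemma node_value_exhausted stage : (0 < stage) ->
  (node_value stage 0 L <= M) = has (fun p => stage <= rank p) (iota 0 L).
Proof.
case: stage => // r _ /=; apply/idP/hasP => [H|[p pin rp]].
  have [|p [pin rp kp]] := @min_key_attained r M.+1 0 L; first lia.
  by exists p; rewrite // mem_iota.
move: (leqnn (min_key r M.+1 0 L)); rewrite leq_min_key => /andP[_ /allP/(_ p pin)].
by rewrite rp /= => /leq_trans; apply; apply: keyM; move: pin; rewrite mem_iota.
Qed.

End Tournament.

(** * The program and its verification *)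

(* Registers: 0 to 3 hold the constants 0 to 3; 4 the value m + 1 of a removed
   leaf; 5 the number L of pairs; 6, 7 and 8 the address, the number of leaves
   and the first leaf of the current subtree; 9 the prefix minimum; 10 the
   stage. A subtree of s leaves occupies 3 s - 1 cells: a leaf consists of its
   value and of the output cell of its pair, an inner node of its value, its
   left subtree and its right subtree. Fork serves as a recursive call. *)
Definition lcs_program : program := [::
  (*  0 *) Const 1 1;
           Const 2 2;
           Const 3 3;
           Read 9 1;
           Arith Add 4 9 1;
           Read 5 2;
           Arith Add 7 5 0;
           Arith Mul 6 5 2;
           Arith Add 6 6 3;
           JumpLt 0 7 12;
  (* 10 *) Write 0 10;
           Halt;
  (* 12: rounds *)
           Fork 17 11;
           Read 16 6;
           JumpLt 9 16 10;
           Arith Add 10 10 1;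
           Jump 12;
  (* 17: visit a subtree *)
           Read 16 6;
           JumpLt 9 16 11;
           JumpLt 1 7 56;
           JumpLt 0 10 51;
  (* 21: initialize a leaf *)
           Arith Mul 17 8 2;
           Arith Add 17 17 3;
           Read 18 17;
           Arith Add 19 18 1;
           Const 20 0;
  (* 26: add to register 20 the number of pairs in rows before register 18 *)
           Const 21 0;
           Arith Add 22 5 0;
  (* 28 *) JumpLt 21 22 39;
           Arith Add 20 20 21;
           JumpLt 18 19 49;
           Arith Defs.Sub 20 20 8;
           Arith Add 12 6 1;
           Write 12 20;
           Arith Mul 17 20 2;
           Arith Add 17 17 2;
           Read 16 17;
           Write 6 16;
           Halt;
  (* 39 *) Arith Add 23 21 22;
           Arith Div 23 23 2;
           Arith Mul 17 23 2;
           Arith Add 17 17 3;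
           Read 16 17;
           JumpLt 16 18 47;
           Arith Add 22 23 0;
           Jump 28;
  (* 47 *) Arith Add 21 23 1;
           Jump 28;
  (* 49 *) Arith Add 18 18 1;
           Jump 26;
  (* 51: extract a leaf *)
           Write 6 4;
           Arith Add 12 6 1;
           Read 16 12;
           Write 16 10;
           Halt;
  (* 56: visit an inner node *)
           Arith Div 11 7 2;
           Arith Add 12 6 1;
           Arith Mul 13 11 3;
           Arith Add 13 6 13;
           Read 14 12;
           Fork 69 72;
           Read 14 12;
           Read 15 13;
           JumpLt 14 15 67;
           Write 6 15;
           Halt;
  (* 67 *) Write 6 14;
           Halt;
  (* 69 *) Arith Add 6 12 0;
           Arith Add 7 11 0;
           Jump 17;
  (* 72 *) Arith Add 6 13 0;
           Arith Defs.Sub 7 7 11;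
           Arith Add 8 8 11;
           JumpLt 9 14 17;
           Arith Add 9 14 0;
           Jump 17].

Ltac regs := rewrite ?/update /=;
  repeat match goal with H : ?f ?r = _ |- context [?f ?r] =>
    lazymatch type of f with registers => rewrite H end end.
Ltac const := eapply safe_const; [reflexivity|try by lia|].
Ltac arith x := eapply safe_arith with (v := x);
  [reflexivity|regs; try by [|lia]|try by [|lia]|].
Ltac read x := eapply safe_read with (v := x);
  [reflexivity|regs; try by []|regs; try by []|try by lia|].
Ltac write b x := eapply safe_write with (a := b) (v := x);
  [reflexivity|regs; try by []|regs; try by []|try by []|].
Ltac jump := eapply safe_jump; [reflexivity|].
Ltac jumplt := eapply safe_jumplt; [reflexivity|regs].
Ltac halt := eapply safe_halt; [reflexivity|].

Section Verification.
Variables (w L M N k : nat) (row col dp lb : nat -> nat) (mem0 : memory).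
Hypothesis lb_leq : forall x, lb x <= L.
Hypothesis row_lt_lb : forall t x, t < L -> (row t < x) = (t < lb x).
Hypothesis rowN : forall t, t < L -> row t <= N.
Hypothesis colM : forall t, t < L -> col t <= M.
Hypothesis col_lt : forall t t', t < t' -> t' < L -> row t = row t' -> col t < col t'.
Hypothesis dp_gt0 : forall t, t < L -> 0 < dp t.
Hypothesis dp_leq : forall t, t < L -> dp t <= k.
Hypothesis dp_lt : forall t t', t < L -> t' < L -> row t < row t' ->
  col t < col t' -> dp t < dp t'.
Hypothesis dp_pred : forall t r, t < L -> r.+1 < dp t ->
  exists t', [/\ t' < L, row t' < row t, col t' < col t & r < dp t'].
Hypothesis dp_attained : forall r, r < k -> exists2 t, t < L & r < dp t.
Hypothesis mem0_1 : mem0 1 = M.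
Hypothesis mem0_2 : mem0 2 = L.
Hypothesis mem0_row : forall t, t < L -> mem0 (3 + 2 * t) = row t.
Hypothesis mem0_col : forall t, t < L -> mem0 (4 + 2 * t) = col t.
Hypothesis mem0_0 : forall c, 3 + 2 * L <= c -> mem0 c = 0.
Hypothesis w_big : 5 * L + M + N + k + 20 < w.

Let base := 3 + 2 * L.

(* Leaf p stands for the pair number [target p - 1], the mirror image of p
   among the pairs of its row: the leaves are ordered by increasing row and,
   within a row, by decreasing column. [target p] is also its output cell. *)
Definition target p := lb (row p) + lb (row p).+1 - p.
Definition key p := col (target p).-1.
Definition rank p := dp (target p).-1.

Lemma row_leq t t' : t <= t' -> t' < L -> row t <= row t'.
Proof.
move=> tt' t'L; have tL : t < L by lia.
by rewrite -ltnS row_lt_lb // (leq_ltn_trans tt') // -row_lt_lb.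
Qed.

Lemma lb_row p : p < L -> lb (row p) <= p < lb (row p).+1.
Proof. by move=> pL; rewrite -row_lt_lb // ltnSn andbT leqNgt -row_lt_lb // ltnn. Qed.

Lemma target_bounds p : p < L -> lb (row p) < target p <= lb (row p).+1.
Proof. by move=> pL; have := lb_row pL; rewrite /target; lia. Qed.

Lemma target_range p : p < L -> 0 < target p <= L.
Proof. by move=> pL; have := target_bounds pL; have := lb_leq (row p).+1; lia. Qed.

Lemma row_target p : p < L -> row (target p).-1 = row p.
Proof.
move=> pL; have := target_bounds pL; have := target_range pL => tL tb.
have tL' : (target p).-1 < L by lia.
by apply/eqP; rewrite eqn_leq -ltnS row_lt_lb // [_ <= row _]leqNgt row_lt_lb //; lia.
Qed.

Lemma targetK p : p < L -> target (target p).-1 = p.+1.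
Proof.
move=> pL; rewrite {1}/target row_target //.
by have := lb_row pL; rewrite /target; lia.
Qed.

Lemma target_inj p q : p < L -> q < L -> target p = target q -> p = q.
Proof. by move=> pL qL e; have := targetK pL; rewrite e targetK // => -[]. Qed.

Lemma keyM p : p < L -> key p <= M.
Proof. by move=> pL; apply: colM; have := target_range pL; lia. Qed.

Lemma rank_gt0 p : p < L -> 0 < rank p.
Proof. by move=> pL; apply: dp_gt0; have := target_range pL; lia. Qed.

Lemma rank_leq p : p < L -> rank p <= k.
Proof. by move=> pL; apply: dp_leq; have := target_range pL; lia. Qed.

Lemma rank_lt p q : p < q -> q < L -> key p < key q -> rank p < rank q.
Proof.
move=> pq qL kpq; have pL : p < L by lia.
have := target_range pL; have := target_range qL => tq tp.
apply: dp_lt => //; try lia.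
rewrite !row_target // ltn_neqAle row_leq ?(ltnW pq) // andbT; apply/eqP => e.
suff H : key q < key p by lia.
apply: col_lt; rewrite ?row_target //; last lia.
by have := lb_row pL; have := lb_row qL; move: tq tp; rewrite /target e; lia.
Qed.

Lemma rank_pred q r : q < L -> r.+1 < rank q ->
  exists p, [/\ p < q, key p < key q & r < rank p].
Proof.
move=> qL; have tq := target_range qL.
have tL : (target q).-1 < L by lia.
move=> /(dp_pred tL)[t [tL' rt ct dt]].
have tt := target_range tL'.
exists (target t).-1; rewrite /key /rank targetK //=; split=> //.
rewrite ltnNge; apply/negP => /row_leq.
rewrite row_target // => H; move: rt; rewrite row_target //.
by have := H; lia.
Qed.

Lemma rank_attained r : r < k -> exists2 p, p < L & r < rank p.
Proof.
move=> /dp_attained[t tL rt]; exists (target t).-1; first by have := target_range tL; lia.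
by rewrite /rank targetK.
Qed.

Lemma dp_leq_index t : t < L -> dp t <= t.+1.
Proof.
elim/ltn_ind: t => t IH tL; case e : (dp t) => [|[|r]] //.
have [|t' [t'L rt _ dt']] := @dp_pred t r tL; first by rewrite e.
have t't : t' < t.
  by rewrite ltnNge; apply/negP => /row_leq /(_ t'L); rewrite leqNgt rt.
by have := IH t' t't t'L; lia.
Qed.

Lemma k_leq_L : k <= L.
Proof.
case ek : k => [|r] //; have [|t tL rt] := @dp_attained r; first by rewrite ek.
by have := dp_leq_index tL; lia.
Qed.

Local Notation safe := (safe w lcs_program).
Local Notation nv := (node_value M key rank).
Local Notation min_prefix := (min_prefix M key rank).
Local Notation active := (active rank).

Definition readable stage c := stage = 0 /\ 3 <= c < 3 + 2 * L.

Definition owned stage a lo s c :=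
  a <= c < a + (3 * s).-1 \/
  0 < stage /\ exists2 p, lo <= p < lo + s & c = target p.

Definition target_cell stage p := if stage is 0 then 0 else target p.

Definition output stage lo s (mem : memory) :=
  forall p, lo <= p < lo + s -> rank p < stage -> mem (target p) = rank p.

(* h bounds the height of the subtree: s <= 2 ^ h. *)
Fixpoint subtree stage (mem : memory) h a lo s :=
  mem a = nv stage lo s /\
  if s <= 1 then mem a.+1 = target_cell stage lo
  else if h is h'.+1 then
    subtree stage mem h' a.+1 lo (s %/ 2) /\
    subtree stage mem h' (a + 3 * (s %/ 2)) (lo + s %/ 2) (s - s %/ 2)
  else False.

Record visit_regs (rs : registers) stage a lo s := VisitRegs {
  reg0 : rs 0 = 0; reg1 : rs 1 = 1; reg2 : rs 2 = 2; reg3 : rs 3 = 3;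
  reg4 : rs 4 = M.+1; reg5 : rs 5 = L; reg6 : rs 6 = a; reg7 : rs 7 = s;
  reg8 : rs 8 = lo; reg9 : rs 9 = min_prefix stage lo; reg10 : rs 10 = stage }.

Lemma subtree_agree stage mem mem' h a lo s : 0 < s ->
  agree (fun c => a <= c < a + (3 * s).-1) mem mem' ->
  subtree stage mem h a lo s -> subtree stage mem' h a lo s.
Proof.
elim: h a lo s => [|h IH] a lo s s0 e /=; rewrite -e; try lia; case=> -> H; split=> //.
  by move: H; case: leqP => // s1; rewrite e //; lia.
move: H; case: leqP => s1; first by rewrite e //; lia.
by case=> Hl Hr; split; [apply: IH Hl|apply: IH Hr]; try lia;
  apply: agree_sub e => c; lia.
Qed.

Lemma subtree_inactive stage mem h a lo s : 0 < s ->
  ~~ has (active stage) (iota lo s) ->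
  subtree stage mem h a lo s -> subtree stage.+1 mem h a lo s.
Proof.
have e lo' s' : 0 < s' -> ~~ has (active stage) (iota lo' s') ->
    target_cell stage.+1 lo' = target_cell stage lo'.
  by case: stage => //; case: s'.
elim: h a lo s => [|h IH] a lo s s0 nact /=.
all: rewrite -/(nv stage.+1 lo s) node_value_inactive //; case=> -> H; split=> //.
all: move: H; rewrite -/(target_cell stage.+1 lo) (e _ _ s0 nact); case: leqP => // s1 [Hl Hr].
have es : s = s %/ 2 + (s - s %/ 2) by lia.
move: nact; rewrite {1}es iotaD has_cat negb_or => /andP[nl nr].
by split; apply: IH => //; lia.
Qed.

Lemma output_agree stage a lo s mem mem' :
  agree (owned stage a lo s) mem mem' -> output stage lo s mem ->
  output stage lo s mem'.
Proof.
move=> e H p pin rp; rewrite -e; first exact: H.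
by right; split; [case: stage rp {e H}|exists p].
Qed.

Lemma output_inactive stage lo s mem : lo + s <= L ->
  ~~ has (active stage) (iota lo s) ->
  output stage lo s mem -> output stage.+1 lo s mem.
Proof.
move=> loL /hasPn nact H p pin; rewrite ltnS leq_eqVlt => /orP[/eqP rp|]; last exact: H.
have := nact p; rewrite mem_iota => /(_ pin).
suff -> : active stage p by [].
by rewrite /active; case: (stage) rp => // r ->; rewrite eqxx.
Qed.

Section Search.
Variables (own rd : nat -> Prop) (mem : memory) (Q : nat -> memory -> Prop).
Variables (x W T : nat).
Hypothesis row_read : forall t, t < L -> union own rd (3 + 2 * t) /\ mem (3 + 2 * t) = row t.

Lemma safe_search g (rs : registers) d :
  rs 0 = 0 -> rs 1 = 1 -> rs 2 = 2 -> rs 3 = 3 -> rs 18 = x ->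
  rs 21 <= lb x <= rs 22 -> rs 22 <= L -> rs 22 - rs 21 < 2 ^ g ->
  d + 9 * g < T ->
  (forall (rs' : registers) d', (forall r, r < 16 \/ 18 <= r < 21 -> rs' r = rs r) ->
     rs' 21 = lb x -> d' <= T ->
     safe W own rd (Running 29 rs' d') mem Q) ->
  safe (W + 9 * g).+1 own rd (Running 28 rs d) mem Q.
Proof.
elim: g rs d => [|g IH] rs d R0 R1 R2 R3 R18 lbx uL ul dT H.
all: jumplt.
  rewrite muln0 addn0 ifF; last by rewrite expn0 in ul; lia.
  by apply: H => //; rewrite expn0 in ul; lia.
case: ifP => lu; last first.
  by apply: (@safe_leq _ _ W); [lia|apply: H => //; lia].
rewrite expnS in ul.
set mid := (rs 21 + rs 22) %/ 2.
have midL : mid < L by rewrite /mid; lia.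
have [um em] := row_read midL.
apply: (@safe_leq _ _ (iter 8 S (W + 9 * g).+1)); first by rewrite /=; lia.
rewrite [iter _ _ _]/=.
arith (rs 21 + rs 22).
arith mid.
arith (mid * 2).
arith (3 + 2 * mid).
read (row mid); first by have := rowN midL; lia.
jumplt; rewrite row_lt_lb //; case: ifP => c.
  arith (mid.+1).
  jump; apply: IH; regs => //; try (by rewrite /mid in c *; lia).
  move=> rs' d' e; apply: H => r rr; rewrite e //.
  by rewrite !ifN //; clear -rr; lia.
arith mid.
jump.
apply: IH; regs => //; try (by rewrite /mid in c *; lia).
move=> rs' d' e; apply: H => r rr; rewrite e //.
by rewrite !ifN //; clear -rr; lia.
Qed.

End Search.

Section Leaf.
Variables (g h a p : nat).
Hypotheses (Lg : L < 2 ^ g) (pL : p < L) (base_a : base <= a).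
Hypothesis (a_end : a + 3 <= base + 3 * L).

Let post stage d d' (mem' : memory) :=
  [/\ d' <= d + (18 * g + 25), subtree stage.+1 mem' h a p 1
    & output stage.+1 p 1 mem'].

Lemma safe_init_leaf rs d mem :
  visit_regs rs 0 a p 1 -> agree (readable 0) mem0 mem ->
  safe (18 * g + 25) (owned 0 a p 1) (readable 0) (Running 21 rs d) mem (post 0 d).
Proof.
case=> R0 R1 R2 R3 R4 R5 R6 R7 R8 R9 R10 em.
have mem_row t : t < L ->
    union (owned 0 a p 1) (readable 0) (3 + 2 * t) /\ mem (3 + 2 * t) = row t.
  by move=> tL; rewrite -em ?mem0_row //; [split=> //; right|]; split=> //; lia.
have [up ep] := mem_row p pL.
have rpN := rowN pL.
have [lo hi] := andP (lb_row pL).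
have lbL := lb_leq (row p).+1.
apply: (@safe_leq _ _ (iter 7 S ((9 * g + 17) + 9 * g).+1)); first by rewrite /=; lia.
rewrite [iter _ _ _]/=.
arith (p * 2).
arith (3 + 2 * p).
read (row p).
arith (row p).+1.
const.
const.
arith L.
apply: (@safe_search _ _ _ _ (row p) _ (d + 7 + 9 * g).+1); regs => //; try lia.
move=> rs1 d1 e1 l1 d1T.
have Q0 : rs1 0 = 0 by rewrite (e1 0 (or_introl isT)); regs.
have Q1 : rs1 1 = 1 by rewrite (e1 1 (or_introl isT)); regs.
have Q2 : rs1 2 = 2 by rewrite (e1 2 (or_introl isT)); regs.
have Q3 : rs1 3 = 3 by rewrite (e1 3 (or_introl isT)); regs.
have Q5 : rs1 5 = L by rewrite (e1 5 (or_introl isT)); regs.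
have Q6 : rs1 6 = a by rewrite (e1 6 (or_introl isT)); regs.
have Q8 : rs1 8 = p by rewrite (e1 8 (or_introl isT)); regs.
have Q18 : rs1 18 = row p by rewrite (e1 18 (or_intror isT)); regs.
have Q19 : rs1 19 = (row p).+1 by rewrite (e1 19 (or_intror isT)); regs.
have Q20 : rs1 20 = 0 by rewrite (e1 20 (or_intror isT)); regs.
clear e1.
apply: (@safe_leq _ _ (iter 6 S ((iter 10 S 0) + 9 * g).+1)); first by rewrite /=; lia.
rewrite [iter 6 _ _]/=.
arith (lb (row p)).
jumplt; rewrite ltnSn.
arith (row p).+1.
jump.
const.
arith L.
apply: (@safe_search _ _ _ _ (row p).+1 _ (d + 14 + 18 * g).+1); regs => //; try lia.
move=> rs2 d2 e2 l2 d2T.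
have S0 : rs2 0 = 0 by rewrite (e2 0 (or_introl isT)); regs.
have S1 : rs2 1 = 1 by rewrite (e2 1 (or_introl isT)); regs.
have S2 : rs2 2 = 2 by rewrite (e2 2 (or_introl isT)); regs.
have S6 : rs2 6 = a by rewrite (e2 6 (or_introl isT)); regs.
have S8 : rs2 8 = p by rewrite (e2 8 (or_introl isT)); regs.
have S18 : rs2 18 = (row p).+1 by rewrite (e2 18 (or_intror isT)); regs.
have S19 : rs2 19 = (row p).+1 by rewrite (e2 19 (or_intror isT)); regs.
have S20 : rs2 20 = lb (row p) by rewrite (e2 20 (or_intror isT)); regs.
clear e2; rewrite /=.
arith (lb (row p) + lb (row p).+1).
jumplt; rewrite ltnn.
have tp := target_range pL.
arith (target p).
arith a.+1.
write a.+1 (target p); first by left; lia.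
arith (target p * 2).
arith (4 + 2 * (target p).-1).
have kM := keyM pL.
read (key p).
- by right; split=> //; lia.
- rewrite ifF; last by lia.
  by rewrite -em ?mem0_col //; [lia|split=> //; lia].
write a (key p); first by left; lia.
halt => mem' e; split; first by lia.
  have v := node_value1 keyM rank_gt0 pL.
  have e1 : mem' a = key p.
    by rewrite -e; [rewrite /update eqxx|left; left; lia].
  have e2 : mem' a.+1 = target p.
    by rewrite -e; [rewrite /update ifF ?eqxx //; lia|left; left; lia].
  by case: (h) => [|h'] /=; rewrite -/(nv 1 p 1) v e1 e2.
by move=> q qin; have := rank_gt0 (_ : q < L); lia.
Qed.

Lemma safe_extract_leaf stage rs d mem :
  0 < stage -> active stage p -> visit_regs rs stage a p 1 ->
  subtree stage mem h a p 1 ->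
  safe 5 (owned stage a p 1) (readable stage) (Running 51 rs d) mem (post stage d).
Proof.
move=> st0 act [R0 R1 R2 R3 R4 R5 R6 R7 R8 R9 R10] sub.
have tp := target_range pL.
have emt : mem a.+1 = target p.
  case: (h) sub => [|h'] /=; case: (stage) st0 => // st _ /= [_ ->] //.
write a M.+1; first by left; lia.
arith a.+1.
read (target p).
- by left; left; lia.
- by rewrite ifF //; lia.
write (target p) stage.
  by right; split=> //; exists p => //; lia.
have rp : rank p = stage by move: act; rewrite /active; case: (stage) st0 => // s _ /eqP.
halt => mem' e; split; first by lia.
  have v := node_value_removed M key st0 act.
  have e1 : mem' a = M.+1.
    rewrite -e; last by left; left; lia.
    by rewrite /update eqxx ifF //; lia.
  have e2 : mem' a.+1 = target p.
    rewrite -e; last by left; left; lia.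
    by rewrite /update !ifF ?emt //; lia.
  by case: (h) => [|h'] /=; rewrite -/(nv stage.+1 p 1) v e1 e2.
move=> q qin _; have -> : q = p by lia.
rewrite -e; last by left; right; split=> //; exists p => //; lia.
by rewrite /update eqxx.
Qed.

End Leaf.


Lemma safe_visit g h stage a lo s (rs : registers) d mem :
  L < 2 ^ g -> 0 < s <= 2 ^ h -> lo + s <= L -> base <= a ->
  a + 3 * s <= base + 3 * L -> visit_regs rs stage a lo s ->
  agree (readable stage) mem0 mem -> subtree stage mem h a lo s ->
  output stage lo s mem ->
  safe (3 + count (active stage) (iota lo s) * (18 * g + 26 + 40 * h))
    (owned stage a lo s) (readable stage) (Running 17 rs d) mem
    (fun d' mem' => [/\ d' <= d + (18 * g + 29 + 40 * h),
       subtree stage.+1 mem' h a lo s & output stage.+1 lo s mem']).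
Proof.
move=> Lg; elim/ltn_ind: h a lo s rs d mem => h IH a lo s rs d mem sh loL base_a
  a_end regs em sub out.
have [R0 R1 R2 R3 R4 R5 R6 R7 R8 R9 R10] := regs.
have s0 : 0 < s by lia.
have ea : mem a = nv stage lo s by case: (h) sub => [|h'] [].
have nvM := node_value_max M key rank stage lo s.
have act := node_value_leq_prefix keyM rank_lt rank_pred stage s0 loL.
rewrite !addSn add0n.
read (nv stage lo s); first by left; left; lia.
jumplt; case: ltnP => pr.
  halt => mem' e; have nact : ~~ has (active stage) (iota lo s) by rewrite -act -ltnNge.
  have e' : agree (owned stage a lo s) mem mem' by apply: agree_sub e => c; left.
  split; first lia.
    apply: subtree_inactive => //; apply: subtree_agree sub => //.
    by apply: agree_sub e' => c; left.
  by apply: output_inactive => //; apply: output_agree e' _.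
have cnt : 0 < count (active stage) (iota lo s) by rewrite -has_count -act.
jumplt; case: ltnP => s1; last first.
  have es : s = 1 by lia.
  clear R7; subst s; have R7 := reg7 regs.
  have ec : count (active stage) (iota lo 1) = active stage lo by exact: addn0.
  move: cnt; rewrite ec lt0b => actp; rewrite actp mul1n.
  have pL : lo < L by lia.
  apply: (@safe_leq _ _ (18 * g + 25).+1); first by lia.
  have le d' : d' <= d.+4 + (18 * g + 25) -> d' <= d + (18 * g + 29 + 40 * h) by lia.
  jumplt; case: ifP => st0.
    apply: (@safe_leq _ _ 5); first by lia.
    apply: (safe_conseq _ (safe_extract_leaf Lg pL base_a _ _ st0 actp _ sub)); try lia.
      by move=> d' mem' [/le ? ? ?]; split.
    by split; regs.
  have st00 : stage = 0 by lia.
  clear R10; subst stage; have R10 := reg10 regs.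
  apply: (safe_conseq _ (safe_init_leaf h Lg pL base_a _ _ _ em)); try lia.
    by move=> d' mem' [/le ? ? ?]; split.
  by split; regs.
case: h sh sub IH => [|h] sh sub IH; first by rewrite expn0 in sh; lia.
rewrite expnS in sh.
set sl := s %/ 2; set sr := s - sl.
have es : s = sl + sr by rewrite /sr /sl; lia.
have sl0 : 0 < sl <= 2 ^ h by rewrite /sl; lia.
have sr0 : 0 < sr <= 2 ^ h by rewrite /sr /sl; lia.
have [subl subr] : subtree stage mem h a.+1 lo sl /\
    subtree stage mem h (a + 3 * sl) (lo + sl) sr.
  by move: sub => /= [_]; rewrite leqNgt s1.
have el : mem a.+1 = nv stage lo sl by case: (h) subl => [|h'] [].
have nvl := node_value_max M key rank stage lo sl.
set cl := count (active stage) (iota lo sl) * (18 * g + 26 + 40 * h).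
set cr := count (active stage) (iota (lo + sl) sr) * (18 * g + 26 + 40 * h).
apply: (@safe_leq _ _ (iter 5 S ((3 + cl).+3 + (iter 6 S (3 + cr)) + 5).+2)).
  move: cnt; rewrite es iotaD count_cat mulnS -/cl -/cr /=.
  rewrite (_ : forall x y, (x + y) * (18 * g + 26 + (40 + 40 * h)) =
    x * (18 * g + 26 + 40 * h) + y * (18 * g + 26 + 40 * h) + 40 * (x + y));
    last by move=> x y; lia.
  by rewrite -/cl -/cr; lia.
rewrite [iter 5 _ _]/=.
have ta q : lo <= q < lo + s -> target q < a.
  by move=> qin; have /target_range : q < L by [lia]; rewrite /base in base_a; lia.
arith sl.
arith a.+1.
arith (sl * 3).
arith (a + 3 * sl).
read (nv stage lo sl).
- by left; left; lia.
eapply (@safe_fork w lcs_program 5 _ _ _ _ _ _ _ _ _ (3 + cl).+3 (iter 6 S (3 + cr))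
  (owned stage a.+1 lo sl) (owned stage (a + 3 * sl) (lo + sl) sr)
  (readable stage) (readable stage)
  (fun d' mem' => [/\ d' <= d + 15 + (18 * g + 29 + 40 * h),
     subtree stage.+1 mem' h a.+1 lo sl & output stage.+1 lo sl mem'])
  (fun d' mem' => [/\ d' <= d + 15 + (18 * g + 29 + 40 * h),
     subtree stage.+1 mem' h (a + 3 * sl) (lo + sl) sr &
     output stage.+1 (lo + sl) sr mem'])).
- reflexivity.
- by move=> c [cin|[st0 [p pin ->]]]; [left; lia|right; split=> //; exists p => //; lia].
- by move=> c [cin|[st0 [p pin ->]]]; [left; lia|right; split=> //; exists p => //; lia].
- by right.
- by right.
- move=> c own1 [own2|]; last first.
    case=> st0 cin; case: own1 => [|[]]; last by rewrite st0.
    by rewrite /base in base_a *; lia.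
  case: own1 own2 => [cin|[_ [p pin ec]]] [cin'|[_ [q qin ec']]]; first lia.
  + have : target q < a by apply: ta; lia.
    by lia.
  + have : target p < a by apply: ta; lia.
    by lia.
  + have : p = q by apply: target_inj; [lia|lia|rewrite -ec].
    by lia.
- move=> c own1 [own2|]; last first.
    case=> st0 cin; case: own1 => [|[]]; last by rewrite st0.
    by rewrite /base in base_a *; lia.
  case: own1 own2 => [cin|[_ [p pin ec]]] [cin'|[_ [q qin ec']]]; first lia.
  + have : target q < a by apply: ta; lia.
    by lia.
  + have : target p < a by apply: ta; lia.
    by lia.
  + have : p = q by apply: target_inj; [lia|lia|rewrite -ec].
    by lia.
- arith a.+1.
  arith sl.
  jump.
  apply: (safe_conseq _ (IH h (ltnSn h) _ _ _ _ _ _ _ _ _ _ _ _ _ _)) => //; try lia.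
    by move=> d' mem' [? ? ?]; split=> //; lia.
  by move=> p pin rp; apply: out => //; lia.
- rewrite [iter 6 _ _]/=.
  have outr : output stage (lo + sl) sr mem.
    by move=> p pin rp; apply: out => //; lia.
  have mpD := min_prefixD M key rank stage lo (proj1 (andP sl0)).
  arith (a + 3 * sl).
  arith sr.
  arith (lo + sl).
  jumplt; case: ltnP => vl.
    apply: (@safe_leq _ _ (3 + cr)); first by lia.
    apply: (safe_conseq _ (IH h (ltnSn h) _ _ _ _ _ _ _ _ _ _ _ _ _ _)) => //; try lia.
      by move=> d' mem2 [? ? ?]; split=> //; lia.
    by split; regs; rewrite // mpD; lia.
  arith (nv stage lo sl).
  jump.
  apply: (safe_conseq _ (IH h (ltnSn h) _ _ _ _ _ _ _ _ _ _ _ _ _ _)) => //; try lia.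
    by move=> d' mem2 [? ? ?]; split=> //; lia.
  by split; regs; rewrite // mpD; lia.
- move=> d1 d2 mem' _ [d1T subl' outl'] [d2T subr' outr'].
  have el' : mem' a.+1 = nv stage.+1 lo sl by case: (h) subl' => [|h'] [].
  have er' : mem' (a + 3 * sl) = nv stage.+1 (lo + sl) sr by case: (h) subr' => [|h'] [].
  have nvl' := node_value_max M key rank stage.+1 lo sl.
  have nvr' := node_value_max M key rank stage.+1 (lo + sl) sr.
  have fin v mem3 : agree (union (owned stage a lo s) (readable stage)) (update mem' a v) mem3 ->
      v = minn (nv stage.+1 lo sl) (nv stage.+1 (lo + sl) sr) ->
      subtree stage.+1 mem3 h.+1 a lo s /\ output stage.+1 lo s mem3.
    move=> e ev.
    have e' : agree (fun c => owned stage a lo s c /\ c <> a) mem' mem3.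
      move=> c [oc /eqP/negbTE ca]; rewrite -e; last by left.
      by rewrite /update ca.
    split.
      split.
        rewrite -e; last by left; left; lia.
        by rewrite /update eqxx ev [in RHS]es node_valueD.
      rewrite leqNgt s1 /=; split.
        apply: subtree_agree subl'; first lia.
        by apply: agree_sub e' => c cin; split; [left|]; lia.
      apply: subtree_agree subr'; first lia.
      by apply: agree_sub e' => c cin; split; [left|]; lia.
    move=> p pin rp; have pL : p < L by lia.
    have tp := ta p pin; have rp0 := rank_gt0 pL.
    rewrite -(e' (target p)); last first.
      by split; [right; split; [lia|exists p]|lia].
    by have [plo|phi] := ltnP p (lo + sl); [apply: outl'|apply: outr'] => //; lia.
  move: (nv stage.+1 lo sl) (nv stage.+1 (lo + sl) sr) el' er' nvl' nvr' fin =>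
    vl vr el' er' nvl' nvr' fin.
  read vl.
  + by left; left; lia.
  read vr.
  + by left; left; lia.
  jumplt; case: ltnP => lr.
    write a vl; first by left; lia.
    halt => mem3 /fin [|? ?]; first lia.
    by split=> //; lia.
  write a vr; first by left; lia.
  halt => mem3 /fin [|? ?]; first lia.
  by split=> //; lia.
Qed.

Lemma subtree_zero mem h a lo s : (forall c, a <= c -> mem c = 0) ->
  0 < s <= 2 ^ h -> subtree 0 mem h a lo s.
Proof.
elim: h a lo s => [|h IH] a lo s mem_0 sh /=; rewrite !mem_0; try lia.
  by split=> //; rewrite ifT //; rewrite expn0 in sh; lia.
rewrite expnS in sh; split=> //; case: leqP => // s1.
by split; apply: IH; try lia; move=> c ac; apply: mem_0; lia.
Qed.

Section Rounds.
Variables (g h : nat).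
Hypotheses (L_gt0 : 0 < L) (Lg : L < 2 ^ g) (Lh : L <= 2 ^ h).

(* Every leaf is visited once when the tree is built (stage 0) and once when it
   is removed. *)
Let pending stage :=
  count (fun p => stage <= rank p) (iota 0 L) + (stage == 0) * L.

Lemma pendingS stage :
  count (active stage) (iota 0 L) + pending stage.+1 <= pending stage.
Proof.
rewrite /pending; case: stage => [|r].
  have := count_size (active 0) (iota 0 L); rewrite size_iota.
  have := @sub_count _ (fun p => 1 <= rank p) (fun p => 0 <= rank p) (fun _ _ => isT) (iota 0 L).
  by lia.
rewrite /= !addn0 -count_predUI.
rewrite [X in _ + X](_ : _ = 0) ?addn0.
  by apply: sub_count => p /= /orP[/eqP <-|/ltnW].
apply/eqP; rewrite -leqn0 leqNgt -has_count; apply/hasPn => p _ /=.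
by case: eqP => // ->; rewrite ltnn.
Qed.

Lemma safe_rounds stage (rs : registers) d mem :
  stage <= k -> visit_regs rs stage base 0 L ->
  agree (readable stage) mem0 mem -> subtree stage mem h base 0 L ->
  output stage 0 L mem ->
  safe ((k - stage).+1 * 10 + pending stage * (18 * g + 26 + 40 * h))
    (fun=> True) (fun=> False) (Running 12 rs d) mem
    (fun d' mem' => [/\ d' <= d + (k - stage).+1 * (18 * g + 40 * h + 35),
       mem' 0 = k & forall t, t < L -> mem' t.+1 = dp t]).
Proof.
have [n en] : exists n, n = k - stage by eexists.
elim/ltn_ind: n stage en rs d mem => n IH stage en rs d mem lek regs em sub out.
have [R0 R1 R2 R3 R4 R5 R6 R7 R8 R9 R10] := regs.
rewrite (_ : min_prefix stage 0 = M) in R9; last by case: (stage).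
set c := 18 * g + 26 + 40 * h; set f := count (active stage) (iota 0 L).
apply: (@safe_leq _ _ ((3 + f * c) + 1 +
  iter 4 S ((k - stage) * 10 + pending stage.+1 * c)).+2).
  have : (f + pending stage.+1) * c <= pending stage * c by rewrite leq_mul2r pendingS orbT.
  by rewrite mulnDl mulSn /=; lia.
eapply (@safe_fork w lcs_program _ _ _ _ _ _ _ _ _ _ (3 + f * c) 1
  (owned stage base 0 L) (fun=> False) (readable stage) (fun=> False)
  (fun d' mem' => [/\ d' <= d.+1 + (18 * g + 29 + 40 * h),
       subtree stage.+1 mem' h base 0 L & output stage.+1 0 L mem'])
  (fun d' _ => d' <= d.+2)).
- reflexivity.
- by [].
- by [].
- by left.
- by [].
- by move=> a _ [].
- by [].
- by apply: safe_visit => //; lia.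
- by halt.
- move=> d1 d2 mem' _ [d1T sub' out'] d2T; rewrite [iter _ _ _]/=.
  have ev : mem' base = nv stage.+1 0 L by case: (h) sub' => [|h'] [].
  have nvM := node_value_max M key rank stage.+1 0 L.
  have exh := @node_value_exhausted L M key rank keyM stage.+1 isT.
  move: (nv stage.+1 0 L) ev nvM exh => v ev nvM exh.
  read v.
  + by left.
  case: (ltnP stage k) => stk.
    have vM : v <= M.
      rewrite exh; have [p pL rp] := rank_attained stk.
      by apply/hasP; exists p; rewrite // mem_iota.
    jumplt; rewrite ltnNge vM /=.
    arith stage.+1.
    jump.
    rewrite (_ : k - stage = (k - stage.+1).+1); last lia.
    apply: (safe_conseq _ (IH (k - stage.+1) _ stage.+1 _ _ _ _ _ _ _ sub' out')) => //; try lia.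
      by move=> d' mem2 [dT ? ?]; split=> //; rewrite mulSn; lia.
    by move=> a [].
  jumplt; rewrite ifT; last first.
    rewrite ltnNge exh; apply/hasPn => p; rewrite mem_iota => pL /=.
    by have := rank_leq (_ : p < L); lia.
  apply: (@safe_leq _ _ 2); first lia.
  write 0 stage.
  halt => mem2 e; have {}e c' : update mem' 0 stage c' = mem2 c' by apply: e; left.
  split; first by rewrite mulSn; lia.
    by rewrite -e /update eqxx; lia.
  move=> t tL; have [tt] := (targetK tL, target_range tL).
  have := out' (target t).-1; rewrite /rank tt => o tr.
  by rewrite -e /update /= o //=; have := dp_leq tL; lia.
Qed.

Lemma safe_lcs_nonempty :
  safe (12 + (k.+1 * 10 + 2 * L * (18 * g + 26 + 40 * h)))
    (fun=> True) (fun=> False) (Running 0 (fun=> 0) 0) mem0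
    (fun d mem => [/\ d <= 12 + k.+1 * (18 * g + 40 * h + 35),
       mem 0 = k & forall t, t < L -> mem t.+1 = dp t]).
Proof.
apply: (@safe_leq _ _ (iter 10 S (k.+1 * 10 + 2 * L * (18 * g + 26 + 40 * h)))).
  by rewrite /=; lia.
rewrite [iter 10 _ _]/=.
const.
const.
const.
read M.
- by left.
arith M.+1.
read L.
- by left.
arith L.
arith (L * 2).
arith base; rewrite /base; try lia.
jumplt; rewrite L_gt0.
have k0 : k - 0 = k by lia.
have e0 : pending 0 <= 2 * L.
  by rewrite /pending; have := count_size (fun p => 0 <= rank p) (iota 0 L); rewrite size_iota; lia.
apply: (@safe_leq _ _ ((k - 0).+1 * 10 + pending 0 * (18 * g + 26 + 40 * h))).
  by rewrite k0 leq_add2l leq_mul2r e0 orbT.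
apply: (safe_conseq _ (@safe_rounds 0 _ _ _ _ _ _ _ _)) => //.
- by move=> d mem [dT ? ?]; split=> //; rewrite k0 in dT; lia.
- by apply: subtree_zero; [exact: mem0_0|lia].
Qed.

End Rounds.

Lemma safe_lcs_empty : L = 0 ->
  safe 12 (fun=> True) (fun=> False) (Running 0 (fun=> 0) 0) mem0
    (fun d mem => d <= 12 /\ mem 0 = 0).
Proof.
move=> L0.
const.
const.
const.
read M.
- by left.
arith M.+1.
read L.
- by left.
arith L.
arith (L * 2).
arith base; rewrite /base; try lia.
jumplt; rewrite L0 /=.
write 0 0.
halt => mem e; split=> //.
by rewrite -e; [rewrite /update|left].
Qed.

End Verification.

(** * The LCS recurrence and the matching pairs *)

Section LCS.
Variable T : eqType.
Implicit Types A B s : seq T.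

Lemma rcons_subseq_rcons s A x y :
  subseq (rcons s y) (rcons A x) =
  if y == x then subseq s A else subseq (rcons s y) A.
Proof.
rewrite -subseq_rev !rev_rcons /=.
case: eqP => _; first by rewrite subseq_rev.
by rewrite -rev_rcons subseq_rev.
Qed.

Lemma is_lcs_match A B s x :
  is_lcs s A B -> is_lcs (rcons s x) (rcons A x) (rcons B x).
Proof.
move=> [/andP[sA sB] max]; split.
  by rewrite /common_subseq !rcons_subseq_rcons eqxx sA.
move=> s'; case/lastP: s' => // s' y; rewrite /common_subseq !rcons_subseq_rcons.
case: eqP => _ H; first by rewrite !size_rcons ltnS max.
by rewrite [size (rcons s x)]size_rcons leqW ?max.
Qed.

Lemma is_lcs_mismatch A B s1 s2 x y : x != y ->
  is_lcs s1 A (rcons B y) -> is_lcs s2 (rcons A x) B ->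
  is_lcs (if size s1 < size s2 then s2 else s1) (rcons A x) (rcons B y).
Proof.
move=> xy [/andP[s1A s1B] max1] [/andP[s2A s2B] max2]; split.
  case: ifP => _; apply/andP; split=> //.
    exact: subseq_trans s2B (subseq_rcons _ _).
  exact: subseq_trans s1A (subseq_rcons _ _).
rewrite (fun_if size) -/(maxn _ _) => s'; case/lastP: s' => // s' z.
rewrite leq_max /common_subseq => /andP[].
have [->|zx] := eqVneq z x => zA zB; apply/orP; [right|left].
  by apply: max2; rewrite /common_subseq zA /=; move: zB; rewrite rcons_subseq_rcons (negbTE xy).
by apply: max1; rewrite /common_subseq zB andbT; move: zA; rewrite rcons_subseq_rcons (negbTE zx).
Qed.

Lemma lcs_dpSS A B i j : lcs_dp A B i.+1 j.+1 =
  if matched A B i.+1 j.+1 then (lcs_dp A B i j).+1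
  else maxn (lcs_dp A B i j.+1) (lcs_dp A B i.+1 j).
Proof. by []. Qed.

Lemma is_lcs_nil A B : A = [::] \/ B = [::] -> is_lcs [::] A B.
Proof.
move=> e; split=> [|s]; first by rewrite /common_subseq !sub0seq.
by case: e => ->; rewrite /common_subseq subseq0 => /andP[]; [move/eqP->|move=> _ /eqP->].
Qed.

Lemma lcs_dpP A B i j : i <= size A -> j <= size B ->
  exists2 s, is_lcs s (take i A) (take j B) & size s = lcs_dp A B i j.
Proof.
elim: i j => [|i IHi] j.
  by exists [::] => //; apply: is_lcs_nil; rewrite take0; left.
elim: j => [|j IHj] iA jB.
  by exists [::] => //; apply: is_lcs_nil; rewrite take0; right.
have [x0 _] : exists2 x0 : T, x0 \in A & true.
  by case: (A) iA => // x l _; exists x; rewrite ?mem_head.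
rewrite lcs_dpSS /matched /= !onthE !(nth_map x0) // (inj_eq Some_inj).
rewrite (take_nth x0 iA) (take_nth x0 jB).
case: eqVneq => [->|ne].
  have [|s lcs <-] := IHi j _ (ltnW jB); first exact: ltnW.
  by exists (rcons s (nth x0 B j)); [apply: is_lcs_match|rewrite size_rcons].
have [s1 + e1] := IHi j.+1 (ltnW iA) jB; have [s2 + e2] := IHj iA (ltnW jB).
rewrite (take_nth x0 iA) (take_nth x0 jB) => lcs2 lcs1.
eexists; first exact: is_lcs_mismatch ne lcs1 lcs2.
by rewrite (fun_if size) e1 e2.
Qed.

Lemma is_lcs_size A B s s' : is_lcs s A B -> is_lcs s' A B -> size s = size s'.
Proof. by move=> [c max] [c' max']; apply/eqP; rewrite eqn_leq max' ?max. Qed.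

Lemma lcs_dp_mono A B i j i' j' : i <= i' -> j <= j' -> i' <= size A -> j' <= size B ->
  lcs_dp A B i j <= lcs_dp A B i' j'.
Proof.
move=> ii jj iA jB.
have [s [/andP[sA sB] _] <-] := lcs_dpP (leq_trans ii iA) (leq_trans jj jB).
have [s' [_ max] <-] := lcs_dpP iA jB.
have sub u v (l : seq T) : u <= v -> subseq (take u l) (take v l).
  by move=> uv; rewrite -(take_takel l uv) take_subseq.
by apply: max; rewrite /common_subseq (subseq_trans sA) ?(subseq_trans sB) ?sub.
Qed.

Lemma mem_matches A B i j : ((i, j) \in matches A B) =
  [&& 0 < i <= size A, 0 < j <= size B & matched A B i j].
Proof.
rewrite /matches mem_filter [RHS]andbA [RHS]andbC; congr (_ && _).
apply/allpairsP/andP => [[[i' j']] [/= + + [-> ->]]|[iA jB]].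
  by rewrite !mem_iota; lia.
by exists (i, j); split; rewrite //= mem_iota; lia.
Qed.

Lemma lcs_dp_match A B i j : (i, j) \in matches A B ->
  lcs_dp A B i j = (lcs_dp A B i.-1 j.-1).+1.
Proof.
by rewrite mem_matches; case: i j => [|i] [|j] /and3P[iA jB m] //; rewrite lcs_dpSS m.
Qed.

Lemma lcs_dp_attained A B i j r : i <= size A -> j <= size B ->
  r < lcs_dp A B i j ->
  exists p : nat * nat, [/\ p \in matches A B, p.1 <= i, p.2 <= j & r < lcs_dp A B p.1 p.2].
Proof.
elim: i j => [|i IHi] // j; elim: j => [|j IHj] // iA jB.
rewrite lcs_dpSS; case: ifP => m rD.
  have rD' : r < lcs_dp A B i.+1 j.+1 by rewrite lcs_dpSS m.
  by exists (i.+1, j.+1); split; rewrite // mem_matches m iA jB.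
move: rD; rewrite leq_max => /orP[/(IHi _ (ltnW iA) jB)|/(IHj iA (ltnW jB))] [p [pm pi pj rp]];
  by exists p; split=> //; lia.
Qed.

Lemma lcs_dp_lt A B (p q : nat * nat) : p \in matches A B -> q \in matches A B ->
  p.1 < q.1 -> p.2 < q.2 -> lcs_dp A B p.1 p.2 < lcs_dp A B q.1 q.2.
Proof.
case: p q => [i j] [i' j'] pm qm /= ii jj; rewrite (lcs_dp_match qm) ltnS.
by move: qm; rewrite mem_matches => /and3P[? ? _]; apply: lcs_dp_mono; lia.
Qed.

Lemma lcs_dp_pred A B (q : nat * nat) r : q \in matches A B -> r.+1 < lcs_dp A B q.1 q.2 ->
  exists p : nat * nat, [/\ p \in matches A B, p.1 < q.1, p.2 < q.2 & r < lcs_dp A B p.1 p.2].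
Proof.
case: q => [i j] qm /=; rewrite (lcs_dp_match qm) ltnS => rq.
have /and3P[iA jB _] : [&& 0 < i <= size A, 0 < j <= size B & matched A B i j]
  by rewrite -mem_matches.
have [||p [pm pi pj rp]] := lcs_dp_attained _ _ rq; try lia.
by exists p; split=> //; lia.
Qed.

Lemma matches_sorted A B : pairwise
  (fun p q : nat * nat => (p.1 < q.1) || (p.1 == q.1) && (p.2 < q.2)) (matches A B).
Proof.
apply: pairwise_filter.
have : pairwise ltn (iota 1 (size B)).
  by rewrite -sorted_pairwise ?iota_ltn_sorted //; apply: ltn_trans.
move: (iota 1 (size B)) => bs bsP; move: 1 (size A) => a n; elim: n a => // n IH a /=.
rewrite pairwise_cat IH andbT pairwise_map; apply/andP; split.
  apply/allrelP => p q /mapP[j _ ->] /allpairsP[[i' j']] [/= + _ ->] /=.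
  by rewrite mem_iota => /andP[-> _].
by apply: sub_pairwise bsP => j j' /= ->; rewrite eqxx orbT.
Qed.

Lemma size_matches A B : size (matches A B) <= size A * size B.
Proof.
rewrite /matches size_filter (leq_trans (count_size _ _)) //.
by rewrite size_allpairs !size_iota.
Qed.

Lemma nth_flatten_pairs (l : seq (nat * nat)) t : t < size l ->
  let f := flatten [seq [:: p.1; p.2] | p <- l] in
  nth 0 f t.*2 = (nth (0, 0) l t).1 /\ nth 0 f t.*2.+1 = (nth (0, 0) l t).2.
Proof. by elim: l t => // p l IH [|t] //= tl; apply: IH. Qed.

Lemma sparse_input_pairs A B t : t < size (matches A B) ->
  let p := nth (0, 0) (matches A B) t in
  sparse_input A B (3 + 2 * t) = p.1 /\ sparse_input A B (4 + 2 * t) = p.2.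
Proof. by move=> /nth_flatten_pairs; rewrite mul2n !addSn add0n. Qed.

Lemma sparse_input_rest A B c :
  3 + 2 * size (matches A B) <= c -> sparse_input A B c = 0.
Proof.
move=> H; apply: nth_default; suff e (l : seq (nat * nat)) :
    size (flatten [seq [:: p.1; p.2] | p <- l]) = 2 * size l by rewrite /= e.
by elim: l => //= p l ->; lia.
Qed.

End LCS.

Lemma ltn_count_sorted (s : seq (nat * nat)) t x :
  pairwise (fun p q : nat * nat => p.1 <= q.1) s -> t < size s ->
  ((nth (0, 0) s t).1 < x) = (t < count (fun p => p.1 < x) s).
Proof.
elim: s t => // p s IH [|t] /= /andP[/allP ps srt] ts.
  case: (ltnP p.1 x) => // xp; rewrite add0n; apply/esym/negbTE; rewrite -leqNgt leqn0.
  rewrite -leqn0 leqNgt -has_count; apply/hasPn => q /ps; lia.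
case: (ltnP p.1 x) => xp; first by rewrite [_ + _]add1n ltnS IH.
rewrite [_ + _]add0n (_ : count _ _ = 0); last first.
  by apply/eqP; rewrite -leqn0 leqNgt -has_count; apply/hasPn => q /ps; lia.
by have := ps (nth (0, 0) s t) (mem_nth _ ts); lia.
Qed.

Lemma work_bound n L k : 0 < L -> L <= n ^ 2 -> k <= L ->
  12 + (k.+1 * 10 +
    2 * L * (18 * (2 * trunc_log 2 n + 2) + 26 + 40 * (2 * trunc_log 2 n + 2)))
  <= bigO_bound 600 (L * trunc_log 2 n).
Proof.
move=> L0 Ln kL; rewrite /bigO_bound.
case el : (trunc_log 2 n) => [|l].
  move/eqP: el; rewrite trunc_log_eq0 /= => n1.
  have {}Ln : L <= 1 by apply: leq_trans Ln _; case: n n1 => [|[]].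
  by rewrite muln0; lia.
by rewrite (maxn_idPr _) ?muln_gt0 ?L0 //; nia.
Qed.

Lemma span_bound n k : 0 < k -> k <= n ->
  12 + k.+1 * (18 * (2 * trunc_log 2 n + 2) + 40 * (2 * trunc_log 2 n + 2) + 35)
  <= bigO_bound 600 (k * trunc_log 2 n).
Proof.
move=> k0 kn; rewrite /bigO_bound.
case el : (trunc_log 2 n) => [|l].
  move/eqP: el; rewrite trunc_log_eq0 /= => n1.
  by rewrite muln0; nia.
by rewrite (maxn_idPr _) ?muln_gt0 ?k0 //; nia.
Qed.

Theorem theorem3p2 :
  exists (P : program) (c C : nat),
  forall (T : eqType) (n m : nat) (A : n.-tuple T) (B : m.-tuple T) (s : seq T),
    m <= n -> is_lcs s A B ->
    let L := size (matches A B) in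
    let k := size s in
    runs_within (n.+2 ^ c) P (sparse_input A B)
      (bigO_bound C (L * trunc_log 2 n))
      (bigO_bound C (k * trunc_log 2 n))
      (fun mem =>
         [/\ mem 0 = k,
             mem 0 = lcs_dp A B n m
           & forall t, t < L ->
               let p := nth (0, 0) (matches A B) t in
               mem t.+1 = lcs_dp A B p.1 p.2]).
Proof.
exists lcs_program, 6, 600 => T n m A B s mn lcs L k.
have sA := size_tuple A; have sB := size_tuple B.
have ek : k = lcs_dp A B n m.
  have [||s' + <-] := @lcs_dpP _ A B n m; rewrite ?sA ?sB //.
  by rewrite !take_oversize ?sA ?sB // => /(is_lcs_size lcs).
have kn : k <= n.
  by case: lcs => /andP[/size_subseq + _] _; rewrite sA.
have Ln : L <= n ^ 2.
  by apply: leq_trans (size_matches A B) _; rewrite sA sB -mulnn leq_mul2l mn orbT.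
pose ms := matches A B.
pose row t := (nth (0, 0) ms t).1; pose col t := (nth (0, 0) ms t).2.
pose dp t := lcs_dp A B (row t) (col t).
pose lb x := count (fun p : nat * nat => p.1 < x) ms.
have in_ms t : t < L -> (row t, col t) \in ms.
  by move=> tL; rewrite -surjective_pairing mem_nth.
have index_of p : p \in ms -> exists2 t, t < L & p = (row t, col t).
  by move=> /(nthP (0, 0))[t tL <-]; exists t; rewrite // -surjective_pairing.
have range t : t < L -> [/\ row t <= n, col t <= m & 0 < dp t].
  move=> /in_ms pm; have := lcs_dp_match pm; rewrite -/(dp t).
  by move: pm; rewrite mem_matches sA sB => /and3P[]; split; lia.
have sorted t t' : t < t' -> t' < L ->
    row t < row t' \/ row t = row t' /\ col t < col t'.
  move=> tt' t'L; have /(pairwiseP (0, 0)) := matches_sorted A B.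
  move=> /(_ t t' (ltn_trans tt' t'L) t'L tt') /orP[|/andP[/eqP]]; by [left|right].
have lb_leq x : lb x <= L by exact: count_size.
have row_lt_lb t x : t < L -> (row t < x) = (t < lb x).
  apply: ltn_count_sorted; apply: sub_pairwise (matches_sorted A B) => p q /=.
  by lia.
have dp_leq t : t < L -> dp t <= k.
  move=> tL; have [rn cm _] := range t tL.
  by rewrite ek lcs_dp_mono ?sA ?sB.
have dp_lt t t' : t < L -> t' < L -> row t < row t' -> col t < col t' -> dp t < dp t'.
  by move=> /in_ms pm /in_ms pm' rr cc; apply: (lcs_dp_lt pm pm').
have dp_pred t r : t < L -> r.+1 < dp t ->
    exists t', [/\ t' < L, row t' < row t, col t' < col t & r < dp t'].
  move=> /in_ms pm /(lcs_dp_pred pm)[p [/index_of[t' t'L ->] rt ct rp]].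
  by exists t'.
have dp_attained r : r < k -> exists2 t, t < L & r < dp t.
  rewrite ek => /lcs_dp_attained[||p [/index_of[t tL ->] _ _ rp]]; rewrite ?sA ?sB //.
  by exists t.
have w_big : 5 * L + m + n + k + 20 < n.+2 ^ 6.
  by rewrite !expnS expn0; rewrite expnS expn1 in Ln; nia.
have mem0_1 : sparse_input A B 1 = m by exact: sB.
have mem0_0 := @sparse_input_rest _ A B.
have kL : k <= L by apply: (k_leq_L row_lt_lb dp_pred dp_attained mem0_1 _ w_big).
apply: safe_runs_within; case: (posnP L) => [L0|L_gt0].
  apply: (@safe_leq _ _ 12); first by rewrite /bigO_bound; lia.
  apply: (safe_conseq _ (safe_lcs_empty mem0_1 _ w_big L0)) => // d mem [d12 mem_0].
  split; first by rewrite /bigO_bound; lia.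
  by rewrite -ek mem_0 L0; split=> //; lia.
have k_gt0 : 0 < k by have [_ _ dp0] := range 0 L_gt0; have := dp_leq 0 L_gt0; lia.
have Lg : L < 2 ^ (2 * trunc_log 2 n + 2).
  have := trunc_log_ltn n (isT : 1 < 2); rewrite -[2 * _ + 2]/(_) -mulnSr mulnC expnM => H.
  by apply: leq_ltn_trans Ln _; rewrite ltn_exp2r.
apply: safe_leq (work_bound L_gt0 Ln kL) _.
apply: safe_conseq (safe_lcs_nonempty lb_leq row_lt_lb _ _ _ _ dp_leq dp_lt dp_pred
  dp_attained mem0_1 _ _ _ mem0_0 w_big L_gt0 Lg (ltnW Lg)) => //.
- move=> d mem [dS mem_0 memS]; split; first exact: leq_trans dS (span_bound k_gt0 kn).
  by rewrite -ek.
- by move=> t /range[].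
- by move=> t /range[].
- by move=> t t' tt' /(sorted t t' tt')[|[_]] //; lia.
- by move=> t /range[].
- by move=> t /sparse_input_pairs[].
- by move=> t /sparse_input_pairs[].
Qed.
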